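(* Let $n\ge 5$ and let $P_{\mathcal G}(n)=\mathrm{conv}\{(x,y)\in\mathbb R^2:\ \exists G \text{ a graph of order } n \text{ with } \alpha(G)=x,\ F(G)=y\}$. Then the polytope $P_{\mathcal G}(n)$ has exactly $n$ facets, defined by the inequalities \[ y\ge (2^k-1)x+2^k(1-k)+n,\quad k=1,2,\dots,n-1, \] and \[ y\le \frac{2^n-n-1}{n-1}(x-1)+n+1. \]
   Context: Graphs are finite, simple, undirected. $\alpha(G)$ is the stability number of $G$ and $F(G)$ (the Fibonacci index) is the number of stable sets of $G$ including the empty set. conv denotes convex hull. *)

(* Defs.v *)
From HB Require Import structures.
From mathcomp Require Import all_boot all_order all_algebra.
From mathcomp Require Import all_classical all_reals all_analysis.

Set Implicit Arguments.
Unset Strict Implicit.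
Unset Printing Implicit Defensive.

Import Order.TTheory GRing.Theory Num.Theory.

Record sgraph := SGraph {
  vertex :> finType;
  edge : rel vertex;
  edge_sym : symmetric edge;
  edge_irr : irreflexive edge
}.

Definition stable (G : sgraph) (S : {set G}) : bool :=
  [forall u in S, forall v in S, ~~ edge u v].

Definition alpha (G : sgraph) : nat := \max_(S : {set G} | stable S) #|S|.

Definition fibonacci_index (G : sgraph) : nat := #|[set S : {set G} | stable S]|.

Local Open Scope classical_set_scope.
Local Open Scope ring_scope.

Section Polyhedra.
Variables (R : realType) (m : nat).
Implicit Types (A P F : set 'rV[R]_m).

Definition conv_hull A : set 'rV[R]_m := smallest (@convex_set R 'rV[R]_m) A.

Definition dotrv (a x : 'rV[R]_m) : R := \sum_i a 0 i * x 0 i.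

Definition affine_indep k (v : 'I_k -> 'rV[R]_m) : Prop :=
  forall l : 'I_k -> R,
    \sum_i l i = 0 -> \sum_i l i *: v i = 0 -> forall i, l i = 0.

(* The maximum number of affinely independent points of A, minus one, so that
   the empty set has dimension -1. The range of k is no restriction, since at
   most m + 1 points of R^m can be affinely independent. *)
Definition affdim A : int :=
  (\max_(k < m.+2 | `[< exists2 v : 'I_k -> 'rV[R]_m,
       forall i, A (v i) & affine_indep v >]) k)%N%:Z - 1.

Definition face P F : Prop :=
  exists a b, (forall x, P x -> dotrv a x <= b) /\
              F = P `&` [set x | dotrv a x = b].

Definition facets P : set (set 'rV[R]_m) :=
  [set F | face P F /\ affdim F = affdim P - 1].

(* The inequality f <= g is valid on P, and F is where it is tight. *)
Definition defined_by P (f g : 'rV[R]_m -> R) F : Prop :=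
  (forall x, P x -> f x <= g x) /\ F = P `&` [set x | f x = g x].

End Polyhedra.

(* A point (x, y) of the plane is a row vector p with x = p 0 0, y = p 0 1. *)
Definition PG (R : realType) (n : nat) : set 'rV[R]_2 :=
  conv_hull [set p : 'rV[R]_2 | exists G : sgraph,
    [/\ #|G| = n, (alpha G)%:R = p 0 0 & (fibonacci_index G)%:R = p 0 1]].
Arguments PG : clear implicits.

(* Main.v *)
(* Write a for the stability number and F for the Fibonacci index of a graph of
   order n. The subsets of a maximum stable set and the singletons outside it give
   F >= 2^a + n - a, with equality for the join of a stable set of size a and a
   clique. Conversely F is at most the largest product of s_i + 1 over a parts
   s_i of sum n (Zykov's theorem on the complement), hence at most
   2^n (3/4)^(n-a), which lies below the chord from (1, n+1) to (n, 2^n) except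
   for small n or a = 1, where the product itself is compared with the chord. So
   PG(n) is the convex n-gon with vertices (k, 2^k + n - k), and its facets are
   the n edges of this polygon. *)

Require Import Defs.
From HB Require Import structures.
From mathcomp Require Import all_boot all_order all_algebra.
From mathcomp Require Import all_classical all_reals all_analysis.
From mathcomp Require Import zify ring lra.

Set Implicit Arguments.
Unset Strict Implicit.
Unset Printing Implicit Defensive.

Import Order.TTheory GRing.Theory Num.Theory.

(** * Zykov's bound on the number of stable sets *)

Section StableSetCount.
Variable G : sgraph.
Implicit Types (u v : G) (S W : {set G}).

Lemma stableP S :
  reflect {in S &, forall u v, ~~ edge u v} (stable S).
Proof.
apply: (iffP forallP) => [h u v uS vS | h u].
  by have /implyP /(_ uS) /forallP /(_ v) /implyP /(_ vS) := h u.
by apply/implyP => uS; apply/forallP => v; apply/implyP => vS; apply: h.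
Qed.

Lemma stable_sub S W : S \subset W -> stable W -> stable S.
Proof.
move=> /fintype.subsetP sub /stableP st; apply/stableP => u v uS vS.
by apply: st; apply: sub.
Qed.

Lemma stable0 : stable (finset.set0 : {set G}).
Proof. by apply/stableP => u v; rewrite inE. Qed.

Lemma stable1 u : stable [set u].
Proof. by apply/stableP => v w; rewrite !inE => /eqP -> /eqP ->; rewrite edge_irr. Qed.

Definition stable_count W : nat := #|[set S : {set G} | stable S && (S \subset W)]|.

Definition neighborhood v : {set G} := v |: [set u | edge v u].

(** Removing [u] is injective on the sets that contain it, and what remains is stable and avoids [u]
    and all its neighbors. *)
Lemma stable_count_containing W u : u \in W ->
  #|[set S : {set G} | [&& stable S, S \subset W & u \in S]]|
    <= stable_count (W :\: neighborhood u).
Proof.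
move=> uW; set A := [set S | _].
have inj : {in A &, injective (fun S : {set G} => S :\ u)}.
  move=> S S' /[!inE] /and3P[_ _ uS] /and3P[_ _ uS'] /= e.
  by rewrite -(finset.setD1K uS) -(finset.setD1K uS') e.
rewrite -(card_in_imset inj).
apply/subset_leq_card/fintype.subsetP => _ /imsetP[S /[!inE] /and3P[st sub uS] ->].
rewrite (stable_sub (subsetDl S _) st) /=; apply/fintype.subsetP => x.
rewrite !inE negb_or => /andP[-> xS] /=; rewrite (fintype.subsetP sub _ xS) andbT.
exact: (stableP _ st).
Qed.

(* Zykov: for v in the largest number of stable sets, the stable sets missing
   the closed neighborhood are as many as those containing v, and those meeting
   it number at most that many for each of its vertices. *)
Lemma stable_count_step W v : v \in W ->
  {in W, forall u, stable_count (W :\: neighborhood u)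
                   <= stable_count (W :\: neighborhood v)} ->
  stable_count W <= #|W :&: neighborhood v|.+1 * stable_count (W :\: neighborhood v).
Proof.
move=> vW vmax; set M := stable_count (W :\: _).
pose cont u := [set S : {set G} | [&& stable S, S \subset W & u \in S]].
have cover : [set S : {set G} | stable S && (S \subset W)] \subset
    [set S : {set G} | stable S && (S \subset W :\: neighborhood v)] :|:
    \bigcup_(u in W :&: neighborhood v) cont u.
  apply/fintype.subsetP => S /[!inE] /andP[st sub]; rewrite st subsetD sub /=.
  have [//|] := boolP [disjoint S & neighborhood v].
  rewrite -setI_eq0 => /set0Pn[x /[!inE] /andP[xS xN]] /=.
  apply/bigcupP; exists x; rewrite !inE ?st ?sub //.
  by rewrite (fintype.subsetP sub _ xS).
apply: leq_trans (subset_leq_card cover) _.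
apply: leq_trans (leq_card_setU _ _) _; rewrite mulSn leq_add2l.
apply: leq_trans (_ : \sum_(u in W :&: neighborhood v) #|cont u| <= _).
  elim/big_rec2: _ => [|u k B _ IH]; first by rewrite cards0.
  by apply: leq_trans (leq_card_setU _ _) _; rewrite leq_add2l.
rewrite -sum_nat_const; apply: leq_sum => u /[!inE] /andP[uW _].
exact: leq_trans (stable_count_containing uW) (vmax _ uW).
Qed.

End StableSetCount.

(** The largest product of [s_i + 1] over [a] parts of sum at most [n]: the base case ignores what
    is left of [n]. The maximum is a [foldr] over [iota] so that small values can be computed. *)
Fixpoint zykov (a n : nat) : nat :=
  if a is a'.+1 then
    foldr maxn 0 [seq s.+1 * zykov a' (n - s) | s <- iota 0 n.+1]
  else 1.

Lemma zykovS a n : zykov a.+1 n = \max_(s < n.+1) s.+1 * zykov a (n - s).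
Proof.
transitivity (foldr maxn 0 [seq s.+1 * zykov a (n - s) | s <- index_iota 0 n.+1]) => //.
by rewrite foldrE big_map big_mkord.
Qed.

Lemma zykov_gt0 a n : 0 < zykov a n.
Proof.
elim: a n => [//|a IH] n; rewrite zykovS.
by apply: leq_trans (leq_bigmax (Ordinal (ltn0Sn n))); rewrite mul1n.
Qed.

Lemma zykovS_ge a n s : s <= n -> s.+1 * zykov a (n - s) <= zykov a.+1 n.
Proof. by move=> sn; rewrite zykovS; apply: (leq_bigmax (Ordinal (_ : s < n.+1))). Qed.

(** Induction on [a], with [W :&: neighborhood v] as one part, for the maximizing [v]. A stable set
    outside the closed neighborhood of [v] can be enlarged by [v], so the bound on its size drops by
    one. *)
Lemma stable_count_le_zykov (G : sgraph) (a : nat) (W : {set G}) :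
  (forall S, stable S -> S \subset W -> #|S| <= a) ->
  stable_count W <= zykov a #|W|.
Proof.
elim: a W => [|a IH] W aW.
  rewrite /= -(cards1 (finset.set0 : {set G})); apply/subset_leq_card.
  apply/fintype.subsetP => S /[!inE] /andP[st sub].
  by rewrite -cards_eq0 -leqn0 aW.
have [W0|[v0 v0W]] := finset.set_0Vmem W.
  rewrite W0 /stable_count; apply: leq_trans (zykov_gt0 _ _).
  rewrite -(cards1 (finset.set0 : {set G})); apply/subset_leq_card.
  by apply/fintype.subsetP => S /[!inE] /andP[_]; rewrite finset.subset0.
pose f u := stable_count (W :\: neighborhood u).
have [v /= vW vmax] := @arg_maxnP _ v0 [in W] f v0W.
apply: leq_trans (stable_count_step vW vmax) _.
apply: leq_trans (zykovS_ge _ (subset_leq_card (subsetIl W (neighborhood v)))).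
rewrite leq_mul2l -cardsD; apply/orP; right; apply: IH => S st sub.
have vS : v \notin S.
  by apply: contraL vW => /(fintype.subsetP sub); rewrite !inE eqxx.
rewrite -ltnS; have -> : #|S|.+1 = #|v |: S| by rewrite cardsU1 vS.
apply: aW; last first.
  rewrite finset.subUset finset.sub1set vW /=; exact: fintype.subset_trans sub (subsetDl _ _).
have nb x : x \in S -> ~~ edge v x.
  by move=> /(fintype.subsetP sub) /[!inE]; rewrite negb_or -andbA => /and3P[].
apply/stableP => x y /setU1P[->|xS] /setU1P[->|yS].
- by rewrite edge_irr.
- exact: nb.
- by rewrite edge_sym; exact: nb.
- exact: (stableP _ st).
Qed.

(** * Numerical estimates: Zykov's product against the chord *)

Lemma zykov1 n : zykov 1 n = n.+1.
Proof.
apply/eqP; rewrite eqn_leq; apply/andP; split.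
  by rewrite zykovS; apply/bigmax_leqP => s _; rewrite muln1.
by apply: leq_trans (zykovS_ge 0 (leqnn n)); rewrite muln1.
Qed.

(* [s + 1 <= 2 ^ s * (3 / 4) ^ (s - 1)] with denominators cleared; tight at 1 and 2. *)
Lemma leq_expn34 s : s.+1 * 4 ^ s.-1 <= 2 ^ s * 3 ^ s.-1.
Proof.
case: s => // s /=; elim: s => [//|s IH]; rewrite !expnS in IH *.
by move: IH; move: (4 ^ s) (2 ^ s) (3 ^ s) => x y z; nia.
Qed.

Lemma zykov_le_exp a n : zykov a n * 4 ^ (n - a) <= 2 ^ n * 3 ^ (n - a).
Proof.
elim: a n => [|a IH] n.
  by rewrite subn0 mul1n -expnMn; case: n => // n; rewrite leq_exp2r.
have [|s es] := @bigop.eq_bigmax _ (fun s : 'I_n.+1 => s.+1 * zykov a (n - s)).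
  by rewrite card_ord.
rewrite zykovS es; have sn : s <= n by rewrite -ltnS.
move: (nat_of_ord s) sn => {es}s sn.
have := leq_mul (leq_expn34 s) (IH (n - s)).
rewrite -!mulnA; set e := n - a.+1.
(* When [s = 0], or when [n - s - a] is truncated, the exponents may add up to more than [e]; the
   surplus [d] is absorbed at the end by [3 ^ d <= 4 ^ d]. *)
have [d] : exists d, s.-1 + (n - s - a) = e + d.
  by exists (s.-1 + (n - s - a) - e); rewrite /e; lia.
move: (n - s - a) => f ed H.
have {}H : s.+1 * zykov a (n - s) * 4 ^ e * 4 ^ d <= 2 ^ n * 3 ^ e * 3 ^ d.
  rewrite -[X in X <= _]mulnA -[X in _ <= X]mulnA -!expnD -ed !expnD -(subnKC sn).
  rewrite expnD addKn; lia.
rewrite mulnA -(leq_pmul2r (_ : 0 < 4 ^ d)) ?expn_gt0 //.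
apply: leq_trans H _; rewrite leq_mul2l; apply/orP; right.
by case: (d) => // k; rewrite leq_exp2r.
Qed.

(** Applied with [m = a - 1] and [j = n - a], this says [(n - 1) * (3/4) ^ (n - a) <= a - 1]. The
    threshold 9 is sharp: [m = 1], [j = 7] fails. *)
Lemma exp43_ge m j : 0 < m -> 9 <= m + j -> (m + j) * 3 ^ j <= m * 4 ^ j.
Proof.
move=> m0 mj; have [j8|] := leqP 8 j; last first.
  by do 8?[case: j mj => [|j] mj //; first by rewrite ?expnS ?expn0; lia].
(* Since [m + j <= m * (j + 1)], the case [m = 1] suffices here. *)
suff H : j.+1 * 3 ^ j <= 4 ^ j.
  apply: leq_trans (_ : m * j.+1 * 3 ^ j <= _); last by rewrite -mulnA leq_mul2l H orbT.
  by rewrite leq_mul2r; apply/orP; right; nia.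
rewrite -(subnKC j8); elim: (j - 8) => [|k IH]; first by rewrite addn0 !expnS !expn0; lia.
have: 8 <= 8 + k := leq_addr _ _; rewrite addnS; move: (8 + k) IH => i + i8.
by rewrite !expnS; move: (3 ^ i) (4 ^ i) => x y; nia.
Qed.

(** The right-hand side is [n - 1] times the height at [a] of the chord from [(1, n + 1)] to
    [(n, 2 ^ n)]. It fails for [n = 4], [a = 2], where two disjoint edges have index 9, above the
    chord. *)
Lemma zykov_le_chord n a : 5 <= n -> 0 < a <= n ->
  n.-1 * zykov a n <= 2 ^ n * a.-1 + n.+1 * (n - a).
Proof.
move=> n5 /andP[a0 an]; have [->|a1] : a = 1 \/ 1 < a by lia.
  by rewrite zykov1; nia.
have [n10|] := leqP 10 n.
  (* For large [n] the term [2 ^ n * a.-1] alone is big enough. *)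
  apply: leq_trans (leq_addr _ _).
  rewrite -(leq_pmul2r (_ : 0 < 4 ^ (n - a))) ?expn_gt0 //.
  have := zykov_le_exp a n; have := @exp43_ge a.-1 (n - a).
  have -> : a.-1 + (n - a) = n.-1 by lia.
  move=> /(_ ltac:(lia) ltac:(lia)).
  move: (3 ^ _) (4 ^ _) (2 ^ _) (zykov _ _) => x y z t; nia.
move=> n10.
(* The remaining [n] from 5 to 9 are checked by evaluation; the pairs with [a > n] in the table hold
   too, with [n - a] equal to 0. *)
have : all (fun n => all (fun a =>
    n.-1 * zykov a n <= 2 ^ n * a.-1 + n.+1 * (n - a)) (iota 2 8)) (iota 5 5).
  by vm_compute.
move=> /allP /(_ n); rewrite mem_iota => /(_ ltac:(lia)) /allP /(_ a); apply.
by rewrite mem_iota; lia.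
Qed.

(** * Fibonacci index against stability number *)

Section GraphBounds.
Variable G : sgraph.
Implicit Types S : {set G}.

Lemma stable_card_le_alpha S : stable S -> #|S| <= alpha G.
Proof. by move=> st; apply: bigop.leq_bigmax_cond. Qed.

Lemma ex_stable_alpha : exists2 S : {set G}, stable S & #|S| = alpha G.
Proof.
have : 0 < #|[pred S : {set G} | stable S]|.
  by apply/card_gt0P; exists finset.set0; rewrite inE stable0.
move=> /(bigop.eq_bigmax_cond (fun S : {set G} => #|S|))[S st e].
by exists S; rewrite // -e.
Qed.

Lemma alpha_bounds : 0 < #|G| -> 0 < alpha G <= #|G|.
Proof.
move=> /card_gt0P[v _]; apply/andP; split.
  by rewrite -(cards1 v); exact: stable_card_le_alpha (stable1 v).
by have [S _ <-] := ex_stable_alpha; exact: max_card.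
Qed.

Lemma fibonacci_index_ge : 2 ^ alpha G + (#|G| - alpha G) <= fibonacci_index G.
Proof.
have [S st <-] := ex_stable_alpha.
pose singles := [set [set v] | v in ~: S].
have -> : #|G| - #|S| = #|singles|.
  by rewrite card_imset; [rewrite [RHS]cardsCs finset.setCK | exact: finset.set1_inj].
have disj : [disjoint powerset S & singles].
  rewrite disjoint_sym; apply/pred0P => T /=; apply: contraTF isT.
  move=> /andP[/imsetP[v /[!inE] vS ->]].
  by rewrite finset.sub1set (negbTE vS).
rewrite -card_powerset; move: disj; rewrite -(leq_card_setU _ _).2 => /eqP <-.
apply/subset_leq_card/fintype.subsetP => T /[!inE] /orP[sub|/imsetP[v _ ->]].
  exact: stable_sub sub st.
exact: stable1.
Qed.

Lemma fibonacci_index_le : 5 <= #|G| ->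
  #|G|.-1 * fibonacci_index G
    <= 2 ^ #|G| * (alpha G).-1 + #|G|.+1 * (#|G| - alpha G).
Proof.
move=> n5; apply: leq_trans (zykov_le_chord n5 (alpha_bounds _)); last by lia.
rewrite leq_mul2l; apply/orP; right.
have -> : fibonacci_index G = stable_count [set: G].
  by apply: eq_card => S; rewrite !inE finset.subsetT andbT.
rewrite -cardsT; apply: stable_count_le_zykov => S st _.
exact: stable_card_le_alpha.
Qed.

End GraphBounds.

(** * Complete split graphs: a stable set of size [k] joined to a clique *)

Section CompleteSplitGraph.
Variables n k : nat.

Definition split_edge : rel 'I_n := fun u v => (u != v) && ((k <= u) || (k <= v)).

Lemma split_edge_sym : symmetric split_edge.
Proof. by move=> u v; rewrite /split_edge eq_sym orbC. Qed.

Lemma split_edge_irr : irreflexive split_edge.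
Proof. by move=> u; rewrite /split_edge eqxx. Qed.

Definition split_graph := SGraph split_edge_sym split_edge_irr.

Let A : {set split_graph} := [set u : 'I_n | u < k].

(** A vertex outside [A] is adjacent to every other vertex, so a stable set containing it has no
    other element. *)
Lemma stable_split (S : {set split_graph}) :
  stable S -> S \subset A \/ exists2 u, u \in ~: A & S = [set u].
Proof.
move=> /stableP st; have [sub|/subsetPn[u uS uA]] := boolP (S \subset A); first by left.
right; exists u; rewrite ?finset.in_setC //; apply/finset.setP => v; rewrite finset.in_set1.
apply/idP/eqP => [vS|->//]; apply/eqP; move: (st _ _ vS uS).
rewrite /= /split_edge; apply: contraNT => ->.
by move: uA; rewrite !inE -leqNgt => ->; rewrite orbT.
Qed.

Hypothesis kn : 0 < k <= n.

Lemma card_split_stable : #|A| = k.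
Proof.
have [_ kn'] := andP kn.
have inj : injective (widen_ord kn') by move=> i j /(congr1 val) /= /val_inj.
rewrite -[RHS]card_ord -(card_imset _ inj).
apply: eq_card => u; rewrite inE; apply/idP/imsetP => [uk|[i _ ->]] /=; last exact: ltn_ord.
by exists (Ordinal uk) => //; apply: val_inj.
Qed.

Lemma alpha_split : alpha split_graph = k.
Proof.
have [k0 _] := andP kn; apply/eqP; rewrite eqn_leq; apply/andP; split.
  apply/bigmax_leqP => S /stable_split[/subset_leq_card|[u _ ->]].
    by rewrite card_split_stable.
  by rewrite cards1.
rewrite -[X in X <= _]card_split_stable; apply: stable_card_le_alpha.
apply/stableP => u v /[!inE] uk vk.
by rewrite /= /split_edge (leqNgt k u) (leqNgt k v) uk vk andbF.
Qed.

Lemma fibonacci_index_split : fibonacci_index split_graph = 2 ^ k + (n - k).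
Proof.
apply/eqP; rewrite eqn_leq; apply/andP; split; last first.
  by have := fibonacci_index_ge split_graph; rewrite alpha_split card_ord.
have -> : n - k = #|[set [set v] | v in ~: A]|.
  rewrite card_imset; last exact: finset.set1_inj.
  by rewrite [RHS]cardsCs finset.setCK card_split_stable card_ord.
rewrite -[X in 2 ^ X]card_split_stable -card_powerset.
apply: leq_trans (leq_card_setU _ _).1; apply/subset_leq_card/fintype.subsetP => S.
rewrite !inE => /stable_split[->//|[u uA ->]].
by rewrite (imset_f (fun v => [set v])) ?orbT.
Qed.

End CompleteSplitGraph.

Local Open Scope classical_set_scope.
Local Open Scope card_scope.
Local Open Scope ring_scope.

(** * Facets of plane polygons *)

Section PlaneGeometry.
Variable R : realType.
Implicit Types (p q : 'rV[R]_2) (C F P : set 'rV[R]_2) (x y t : R).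

Definition pt x y : 'rV[R]_2 := \row_j (if j == 0 then x else y).

Lemma pt_fst x y : pt x y 0 0 = x. Proof. by rewrite mxE. Qed.
Lemma pt_snd x y : pt x y 0 1 = y. Proof. by rewrite mxE. Qed.

Lemma row2P p q : p 0 0 = q 0 0 -> p 0 1 = q 0 1 -> p = q.
Proof.
move=> e0 e1; apply/rowP => j; case: j => -[|[|//]] ij.
  by have -> : Ordinal ij = 0 by apply: val_inj.
by have -> : Ordinal ij = 1 by apply: val_inj.
Qed.

Lemma dotrv2 p q : dotrv p q = p 0 0 * q 0 0 + p 0 1 * q 0 1.
Proof. by rewrite /dotrv big_ord_recl big_ord1; congr (_ + p 0 _ * q 0 _); apply: val_inj. Qed.

Lemma convex_setE C : @convex_set R 'rV[R]_2 C <->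
  forall p q t, C p -> C q -> 0 <= t <= 1 -> C (t *: p + (1 - t) *: q).
Proof.
split=> [cvx p q t Cp Cq t01 | cvx p q t].
  by have := cvx p q (@Itv01 _ t (andP t01).1 (andP t01).2); rewrite !inE; exact.
by rewrite !inE => Cp Cq; apply: cvx => //; apply/andP; split.
Qed.

Definition has_aff k F := `[< exists2 v : 'I_k -> 'rV[R]_2, forall i, F (v i) & affine_indep v >].

Lemma affdim2E F : affdim F =
  (if has_aff 3 F then 3%N else if has_aff 2 F then 2%N
   else if has_aff 1 F then 1%N else 0%N)%:Z - 1.
Proof.
rewrite /affdim; congr (_%:Z - 1).
rewrite big_mkcond !big_ord_recl big_ord0 /= -!/(has_aff _ _).
rewrite /bump /=.
by case: (has_aff 3 F); case: (has_aff 2 F); case: (has_aff 1 F); case: (has_aff 0 F).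
Qed.

(** The vectors orthogonal to [a] form the line spanned by [d]; the determinant expresses membership
    in that line without mentioning [a]. *)
Lemma det_eq0P (a d e : 'rV[R]_2) : a != 0 -> d != 0 -> dotrv a d = 0 ->
  (dotrv a e = 0) <-> (d 0 0 * e 0 1 - d 0 1 * e 0 0 = 0).
Proof.
have nz (w : 'rV[R]_2) z : w != 0 -> w 0 0 * z = 0 -> w 0 1 * z = 0 -> z = 0.
  move=> /eqP w0 /eqP; rewrite mulf_eq0 => /orP[/eqP w00|/eqP //] /eqP.
  rewrite mulf_eq0 => /orP[/eqP w01|/eqP //].
  by case: w0; apply: row2P; rewrite mxE.
move=> a0 d0; rewrite !dotrv2 => ad; split=> h.
  apply: (nz a) => //.
    by transitivity ((a 0 0 * d 0 0 + a 0 1 * d 0 1) * e 0 1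
      - d 0 1 * (a 0 0 * e 0 0 + a 0 1 * e 0 1)); [ring | rewrite ad h; ring].
  by transitivity (d 0 0 * (a 0 0 * e 0 0 + a 0 1 * e 0 1)
    - (a 0 0 * d 0 0 + a 0 1 * d 0 1) * e 0 0); [ring | rewrite ad h; ring].
apply: (nz d) => //.
  by transitivity ((a 0 0 * d 0 0 + a 0 1 * d 0 1) * e 0 0
    + a 0 1 * (d 0 0 * e 0 1 - d 0 1 * e 0 0)); [ring | rewrite ad h; ring].
by transitivity ((a 0 0 * d 0 0 + a 0 1 * d 0 1) * e 0 1
  - a 0 0 * (d 0 0 * e 0 1 - d 0 1 * e 0 0)); [ring | rewrite ad h; ring].
Qed.

Lemma dotrv_gt0 (a : 'rV[R]_2) : a != 0 -> 0 < dotrv a a.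
Proof.
move=> a0; rewrite dotrv2 -!expr2 lt_neqAle addr_ge0 ?sqr_ge0 // andbT eq_sym.
rewrite paddr_eq0 ?sqr_ge0 // !sqrf_eq0; apply: contra a0 => /andP[/eqP h0 /eqP h1].
by apply/eqP/row2P; rewrite mxE.
Qed.

Lemma dotrvB (a p q : 'rV[R]_2) : dotrv a (p - q) = dotrv a p - dotrv a q.
Proof. by rewrite !dotrv2 !mxE; ring. Qed.

Lemma dotrv_conv (a p q : 'rV[R]_2) t :
  dotrv a (t *: p + (1 - t) *: q) = t * dotrv a p + (1 - t) * dotrv a q.
Proof. by rewrite !dotrv2 !mxE; ring. Qed.

(** Both equations describe the line through [p] and [q]: each is equivalent to the vanishing of the
    determinant of [p - q] and [r - p]. *)
Lemma line_unique (a a' p q r : 'rV[R]_2) (b b' : R) :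
  a != 0 -> a' != 0 -> p <> q ->
  dotrv a p = b -> dotrv a q = b -> dotrv a' p = b' -> dotrv a' q = b' ->
  dotrv a r = b <-> dotrv a' r = b'.
Proof.
move=> a0 a'0 pq ap aq a'p a'q; have d0 : p - q != 0 by rewrite subr_eq0; apply/eqP.
have D c w : c != 0 -> dotrv c p = w -> dotrv c q = w ->
    dotrv c r = w <-> (p - q) 0 0 * (r - p) 0 1 - (p - q) 0 1 * (r - p) 0 0 = 0.
  move=> c0 cp cq; rewrite -(@det_eq0P c) // ?dotrvB ?cp ?cq ?subrr //.
  by split=> [->|/eqP]; rewrite ?subrr // subr_eq0 => /eqP.
by rewrite (D a) // (D a').
Qed.

Lemma sum3 (V : zmodType) (f : 'I_3 -> V) : \sum_i f i = f 0 + f 1 + f 2%:R.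
Proof.
rewrite !big_ord_recl big_ord0 addr0 addrA.
by congr (f _ + f _ + f _); apply: val_inj.
Qed.

(** Cramer's rule: times the determinant of [q - p] and [r - p], the coefficients of [q] and [r] are
    combinations of the three vanishing sums. *)
Lemma has_aff3P F (p q r : 'rV[R]_2) : F p -> F q -> F r ->
  (q 0 0 - p 0 0) * (r 0 1 - p 0 1) != (r 0 0 - p 0 0) * (q 0 1 - p 0 1) ->
  has_aff 3 F.
Proof.
move=> Fp Fq Fr det; apply/asboolP.
exists (fun i : 'I_3 => if i == 0 then p else if i == 1 then q else r).
  by move=> i; case: ifP => // _; case: ifP.
move=> l; rewrite !sum3 /= => s0 /rowP e.
have := e 0; have := e 1; rewrite !mxE => e1 e0.
rewrite -subr_eq0 in det; have l1 : l 1 = 0.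
  apply: (mulIf det); rewrite mul0r.
  transitivity ((r 0 1 - p 0 1) * (l 0 * p 0 0 + l 1 * q 0 0 + l 2%:R * r 0 0)
    - (r 0 0 - p 0 0) * (l 0 * p 0 1 + l 1 * q 0 1 + l 2%:R * r 0 1)
    - (l 0 + l 1 + l 2%:R) * (p 0 0 * (r 0 1 - p 0 1) - p 0 1 * (r 0 0 - p 0 0))).
    by ring.
  by rewrite e0 e1 s0; ring.
have l2 : l 2%:R = 0.
  apply: (mulIf det); rewrite mul0r.
  transitivity ((q 0 0 - p 0 0) * (l 0 * p 0 1 + l 1 * q 0 1 + l 2%:R * r 0 1)
    - (q 0 1 - p 0 1) * (l 0 * p 0 0 + l 1 * q 0 0 + l 2%:R * r 0 0)
    - (l 0 + l 1 + l 2%:R) * (p 0 1 * (q 0 0 - p 0 0) - p 0 0 * (q 0 1 - p 0 1))).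
    by ring.
  by rewrite e0 e1 s0; ring.
have l0 : l 0 = 0 by move: s0; rewrite l1 l2 !addr0.
by case => -[|[|[|//]]] ij; [rewrite -[RHS]l0 | rewrite -[RHS]l1 | rewrite -[RHS]l2];
  congr l; apply: val_inj.
Qed.

Lemma has_aff2P F : has_aff 2 F <-> exists p q, [/\ F p, F q & p <> q].
Proof.
split=> [/asboolP[v Fv ind]|[p [q [Fp Fq pq]]]].
  exists (v 0), (v 1); split => // v01.
  have := ind (fun i => if i == 0 then 1 else -1).
  rewrite !big_ord_recl !big_ord0 /= !addr0.
  have -> : lift ord0 ord0 = 1 :> 'I_2 by apply: val_inj.
  rewrite -v01 scale1r scaleN1r !subrr => /(_ erefl erefl 0) /=.
  by move=> /eqP; rewrite oner_eq0.
apply/asboolP; exists (fun i : 'I_2 => if i == 0 then p else q) => [i|l].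
  by case: ifP.
rewrite !big_ord_recl !big_ord0 /= !addr0.
have -> : lift ord0 ord0 = 1 :> 'I_2 by apply: val_inj.
move=> /eqP; rewrite addrC addr_eq0 => /eqP l1; rewrite l1 scaleNr -scalerBr => /eqP.
rewrite scaler_eq0 subr_eq0 => /orP[/eqP l0|/eqP //] i.
by case: i => -[|[|//]] ij; [rewrite -[RHS]l0 | rewrite -[RHS]oppr0 -l0 -l1];
  congr l; apply: val_inj.
Qed.

(** On the line, a point is determined by its coordinate [h] in the direction orthogonal to [a], so
    affine dependence can be tested on [h] alone. *)
Lemma line_not_has_aff3 F (a : 'rV[R]_2) b : a != 0 ->
  (forall p, F p -> dotrv a p = b) -> ~~ has_aff 3 F.
Proof.
move=> a0 Fab; apply/negP => /asboolP[v Fv ind].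
pose h p : R := - a 0 1 * p 0 0 + a 0 0 * p 0 1.
have key (l : 'I_3 -> R) : \sum_i l i = 0 ->
    l 0 * h (v 0) + l 1 * h (v 1) + l 2%:R * h (v 2%:R) = 0 -> forall i, l i = 0.
  move=> s0 hs; apply: ind => //.
  have dw : \sum_i l i * dotrv a (v i) = 0.
    by under eq_bigr do rewrite Fab //; rewrite -mulr_suml s0 mul0r.
  move: hs dw; rewrite !sum3 /h !dotrv2 => hs dw.
  have /mulfI inj : dotrv a a != 0 by rewrite gt_eqF ?dotrv_gt0.
  have h0 := congr1 ( *%R (a 0 0)) hs; have h1 := congr1 ( *%R (a 0 1)) hs.
  have d0 := congr1 ( *%R (a 0 0)) dw; have d1 := congr1 ( *%R (a 0 1)) dw.
  by apply: row2P; apply: inj; rewrite !mxE dotrv2; lra.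
(* Cyclic differences give an affine dependence of any three reals. If they all vanish, then
   [h (v 0) = h (v 1)] and the coefficients 1, -1, 0 give a nontrivial one. *)
pose l1 i := [:: h (v 1) - h (v 2%:R); h (v 2%:R) - h (v 0); h (v 0) - h (v 1)]`_i.
have := key (fun i : 'I_3 => l1 i); rewrite sum3 /l1 /= => /(_ ltac:(ring) ltac:(ring)) h0.
have h01 : h (v 0) = h (v 1) by apply/eqP; rewrite -subr_eq0; apply/eqP; exact: (h0 2%:R).
have := key (fun i : 'I_3 => [:: 1; -1; 0]`_i); rewrite sum3 /= h01.
move=> /(_ ltac:(ring) ltac:(ring) 0) /= /eqP.
by rewrite oner_eq0.
Qed.

(** Finitely many positive slacks [u] stay nonnegative on a short move towards slacks [w], since the
    new slack is at least [u - t * (u + |w|)]. *)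
Lemma ex_small_step N (u w : nat -> R) : (forall i, (i < N)%N -> 0 < u i) ->
  exists2 e, 0 < e & forall t, 0 <= t <= e ->
    forall i, (i < N)%N -> 0 <= t * w i + (1 - t) * u i.
Proof.
elim: N => [|N IH] u0; first by exists 1.
have [i iN|e e0 he] := IH; first by apply: u0; exact: ltnW.
have uN := u0 N (ltnSn N).
have den : 0 < u N + `|w N| by rewrite ltr_wpDr.
exists (Num.min e (u N / (u N + `|w N|))).
  by rewrite lt_min e0 divr_gt0.
move=> t; rewrite le_min => /andP[t0 /andP[te tu]] i.
rewrite ltnS leq_eqVlt => /orP[/eqP ->|]; last by apply: he; rewrite t0.
move: tu; rewrite ler_pdivlMr // mulrDr => tu.
have : t * - `|w N| <= t * w N by rewrite ler_wpM2l // lerNl -normrN ler_norm.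
by nra.
Qed.

(** * Intersections of half-planes and their facets *)

Section Polygon.
Variables (N : nat) (a : nat -> 'rV[R]_2) (b : nat -> R).

Definition polygon : set 'rV[R]_2 := [set p | forall i, (i < N)%N -> dotrv (a i) p <= b i].
Definition polygon_edge i := polygon `&` [set p | dotrv (a i) p = b i].

Hypothesis a0 : forall i, (i < N)%N -> a i != 0.
Hypothesis full : has_aff 3 polygon.
Hypothesis edges : forall i, (i < N)%N ->
  exists p q, [/\ polygon_edge i p, polygon_edge i q & p <> q].

Lemma affdim_polygon : affdim polygon = 2.
Proof. by rewrite affdim2E full. Qed.

Lemma polygon_edge_facet i : (i < N)%N -> facets polygon (polygon_edge i).
Proof.
move=> iN; split; first by exists (a i), (b i); split => // p; apply.
rewrite affdim_polygon affdim2E (negbTE (@line_not_has_aff3 _ (a i) (b i) _ _)) ?a0 //.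
  by have /has_aff2P -> := edges iN.
by move=> p [].
Qed.

(* The midpoint of two points of the facet would be interior to the polygon,
   were no edge inequality tight at it. *)
Lemma facet_polygon_edge F : facets polygon F ->
  exists2 i, (i < N)%N & F = polygon_edge i.
Proof.
move=> [[c [d [valid ->]]]]; set F' := _ `&` _; rewrite affdim_polygon affdim2E => dimF.
have n3 : ~~ has_aff 3 F' by apply/negP => h; move: dimF; rewrite h.
have : has_aff 2 F' by move: dimF; rewrite (negbTE n3); case: ifP => //; case: ifP.
move=> /has_aff2P[p [q [[Pp /= cp] [Pq /= cq] pq]]].
(* With [c = 0] the face would be the whole polygon, which has three affinely independent points. *)
have c0 : c != 0.
  apply: contraNneq n3 => c0; suff -> : F' = polygon by [].
  rewrite /F'; apply/seteqP; split => [r []//|r Pr]; split => //=.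
  by rewrite -cp c0 !dotrv2 !mxE !mul0r.
pose m := 2^-1 *: p + (1 - 2^-1) *: q.
have cm : dotrv c m = d by rewrite dotrv_conv cp cq; field.
(* An edge inequality tight at the midpoint is tight at [p] and [q], so its line is the line of the
   facet. *)
have [[i [iN mi]]|none] := pselect (exists i, (i < N)%N /\ b i <= dotrv (a i) m).
  have pi := Pp i iN; have qi := Pq i iN.
  move: mi; rewrite dotrv_conv => mi.
  exists i => //; apply/seteqP.
  have E r : dotrv c r = d <-> dotrv (a i) r = b i.
    by apply: (@line_unique _ _ p q) => //; [exact: a0 | lra | lra].
  by split => r [Pr] /= /E.
exfalso; have [i iN|e e0 he] := @ex_small_step N
    (fun i => b i - dotrv (a i) m) (fun i => b i - dotrv (a i) (m + c)).
  by rewrite subr_gt0 ltNge; apply/negP => h; apply: none; exists i.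
(* This point is [m + e *: c]: still in the polygon, yet its product with [c] exceeds [d] by
   [e * dotrv c c > 0]. *)
have Pr : polygon (e *: (m + c) + (1 - e) *: m).
  move=> i iN; have := he e _ i iN; rewrite lexx ltW // => /(_ isT).
  by rewrite (dotrv_conv _ (m + c) m); lra.
have := valid _ Pr; rewrite dotrv_conv cm.
have -> : dotrv c (m + c) = d + dotrv c c by rewrite -cm !dotrv2 !mxE; ring.
by have := mulr_gt0 e0 (dotrv_gt0 c0); lra.
Qed.

End Polygon.
End PlaneGeometry.

(** * The Fibonacci polygon *)

Section FibonacciPolygon.
Variables (R : realType) (n : nat).
Hypothesis hn : (5 <= n)%N.
Implicit Types (p q : 'rV[R]_2) (x y : R) (j k : nat).

Definition lower k p : R := (2 ^+ k - 1) * p 0 0 + 2 ^+ k * (1 - k%:R) + n%:R.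
Definition slope : R := (2 ^+ n - n%:R - 1) / (n%:R - 1).
Definition upper p : R := slope * (p 0 0 - 1) + n%:R + 1.

(* Edge 0 is the upper one; for 0 < k < n, edge k joins vertices k and k + 1. *)
Definition edge_normal k : 'rV[R]_2 :=
  if k is 0 then pt (- slope) 1 else pt (2 ^+ k - 1) (- 1).
Definition edge_offset k : R :=
  if k is 0 then n%:R + 1 - slope else - (2 ^+ k * (1 - k%:R) + n%:R).

Definition vtx k : 'rV[R]_2 := pt k%:R (2 ^+ k + n%:R - k%:R).

Lemma edge_normal_neq0 k : edge_normal k != 0.
Proof.
apply/eqP => /rowP /(_ 1); case: k => [|k]; rewrite !mxE /=; first by move/eqP; rewrite oner_eq0.
by move/eqP; rewrite oppr_eq0 oner_eq0.
Qed.

Lemma upper_leE p : (p 0 1 <= upper p) = (dotrv (edge_normal 0) p <= edge_offset 0).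
Proof. by rewrite dotrv2 pt_fst pt_snd /upper /=; apply/idP/idP; lra. Qed.

Lemma upper_eqE p : (p 0 1 = upper p) <-> (dotrv (edge_normal 0) p = edge_offset 0).
Proof. by rewrite dotrv2 pt_fst pt_snd /upper /=; split; lra. Qed.

Lemma lower_leE k p : (0 < k)%N ->
  (lower k p <= p 0 1) = (dotrv (edge_normal k) p <= edge_offset k).
Proof.
by case: k => // k _; rewrite dotrv2 pt_fst pt_snd /lower /=; apply/idP/idP; lra.
Qed.

Lemma lower_eqE k p : (0 < k)%N ->
  (lower k p = p 0 1) <-> (dotrv (edge_normal k) p = edge_offset k).
Proof.
by case: k => // k _; rewrite dotrv2 pt_fst pt_snd /lower /=; split; lra.
Qed.

Lemma natr_expn2_gt j : j%:R + 1 <= 2 ^+ j :> R.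
Proof. by rewrite -natrX natr1 ler_nat; exact: ltn_expl. Qed.

(** Divided by [2 ^+ k], this is [i + 1 <= 2 ^ i] for the integer [i = j - k], whose left side is at
    most 0 when [j < k]. It places every vertex on or above each lower line. *)
Lemma expn2_tangent j k : 2 ^+ k * (j%:R - k%:R + 1) <= 2 ^+ j :> R.
Proof.
have k0 : 0 < 2 ^+ k :> R by rewrite exprn_gt0.
have [kj|jk] := leqP k j.
  rewrite -(subnKC kj) exprD ler_pM2l // natrD.
  by have := natr_expn2_gt (j - k); lra.
apply: (@le_trans _ _ 0); last by rewrite exprn_ge0.
rewrite pmulr_rle0 //; have : j.+1%:R <= k%:R :> R by rewrite ler_nat.
by rewrite -natr1; lra.
Qed.

Lemma expn_pred : 2 ^+ n = 2 * 2 ^+ n.-1 :> R.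
Proof. by rewrite -exprS prednK //; lia. Qed.

Lemma natr_ge5 : 5 <= n%:R :> R.
Proof. by rewrite (ler_nat _ 5). Qed.

Lemma expn_pred_gt : n%:R < 2 ^+ n.-1 :> R.
Proof.
have := natr_expn2_gt n.-2; have n2 : n = n.-2.+2 by lia.
by rewrite n2 /= exprS -!natr1; have := natr_ge5; rewrite {1}n2 -!natr1; lra.
Qed.

Lemma slopeM : slope * (n%:R - 1) = 2 ^+ n - n%:R - 1.
Proof. by rewrite /slope mulfVK // subr_eq0 gt_eqF //; have := natr_ge5; lra. Qed.

Lemma slope_gt1 : 1 < slope.
Proof.
have := natr_ge5; have := expn_pred_gt => h h5.
rewrite /slope ltr_pdivlMr; last by lra.
by rewrite expn_pred; lra.
Qed.

Lemma slope_lt : slope < 2 ^+ n.-1 - 1.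
Proof.
have := natr_ge5; have := expn_pred_gt => h h5.
rewrite /slope ltr_pdivrMr; last by lra.
by rewrite expn_pred; nra.
Qed.

Lemma vtx_lower_tight k : lower k (vtx k) = vtx k 0 1.
Proof. by rewrite /lower pt_fst pt_snd; ring. Qed.

Lemma vtx_lower_tightS k : lower k (vtx k.+1) = vtx k.+1 0 1.
Proof. by rewrite /lower pt_fst pt_snd exprS -natr1; ring. Qed.

Lemma vtx_upper1 : vtx 1 0 1 = upper (vtx 1).
Proof. by rewrite /upper pt_fst pt_snd; ring. Qed.

Lemma vtx_uppern : vtx n 0 1 = upper (vtx n).
Proof. by rewrite /upper pt_fst pt_snd slopeM; ring. Qed.

Definition graph_points : set 'rV[R]_2 := [set p | exists G : sgraph,
  [/\ #|G| = n, (alpha G)%:R = p 0 0 & (fibonacci_index G)%:R = p 0 1]].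

Lemma vtx_graph_point k : (0 < k <= n)%N -> graph_points (vtx k).
Proof.
move=> /andP[k0 kn]; exists (split_graph n k); split; first exact: card_ord.
  by rewrite alpha_split ?k0 // pt_fst.
by rewrite fibonacci_index_split ?k0 // pt_snd natrD natrX natrB //; ring.
Qed.

Definition fib_polygon := polygon n edge_normal edge_offset.

Lemma fib_polygonP p : fib_polygon p <->
  (forall k, (0 < k < n)%N -> lower k p <= p 0 1) /\ p 0 1 <= upper p.
Proof.
split=> [Pp|[lo up] [|k] kn].
- split=> [k /andP[k0 kn]|]; first by rewrite lower_leE //; exact: Pp.
  by rewrite upper_leE; apply: Pp; lia.
- by rewrite -upper_leE.
- by rewrite -lower_leE //; apply: lo.
Qed.

Lemma graph_points_sub : graph_points `<=` fib_polygon.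
Proof.
move=> p [G [Gn]]; have := @fibonacci_index_le G; have := fibonacci_index_ge G.
have := @alpha_bounds G; rewrite Gn => /(_ ltac:(lia)) + + /(_ hn).
move: (alpha G) (fibonacci_index G) => a f /andP[a0 an] ge le pa pf.
move: ge le; rewrite -!(ler_nat R) !natrD !natrM !natrX (natrB _ an) pa pf => ge le.
apply/fib_polygonP; split=> [k _|].
  by rewrite /lower; have := expn2_tangent a k; rewrite pa; move: ge; lra.
have n1 : n.-1%:R = n%:R - 1 :> R by rewrite -subn1 natrB //; lia.
have a1 : a.-1%:R = p 0 0 - 1 by rewrite -subn1 natrB // pa.
have n0 : 0 < n%:R - 1 :> R by have := natr_ge5; lra.
rewrite n1 a1 -natr1 in le.
by rewrite -(ler_pM2l n0) /upper; have := congr1 ( *%R (p 0 0 - 1)) slopeM; lra.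
Qed.

(** The upper line meets [lower 1] at abscissa 1 and [lower n.-1] at abscissa [n], and its slope
    lies strictly between theirs. *)
Lemma fib_polygon_bounds p : fib_polygon p -> 1 <= p 0 0 <= n%:R.
Proof.
move=> /fib_polygonP[lo up]; have s1 := slope_gt1; have s2 := slope_lt.
have := lo 1%N ltac:(lia); have := lo n.-1 ltac:(lia).
have n1 : n.-1%:R = n%:R - 1 :> R by rewrite -subn1 natrB //; lia.
move: up; rewrite /lower /upper n1 => up l1 l2; apply/andP; split; first by nra.
by have := slopeM; rewrite expn_pred; nra.
Qed.

Lemma ex_unit_interval (N : nat) x : (0 < N)%N -> 1 <= x <= N.+1%:R ->
  exists k, (0 < k <= N)%N /\ k%:R <= x <= k%:R + 1.
Proof.
elim: N => [//|[|N] IH] _ /andP[x1 xN].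
  by exists 1%N; rewrite x1; split => //; move: xN; rewrite -natr1; lra.
have [xle|xgt] := leP x N.+2%:R.
  by have [|k [kN kx]] := IH isT; [rewrite x1 | exists k; split => //; lia].
by exists N.+2; split; [lia | rewrite ltW //= natr1].
Qed.

(* A point of the polygon lies on the vertical segment from the chord of two
   consecutive vertices up to the chord of the extreme ones. *)
Lemma fib_polygon_sub C : @convex_set R 'rV[R]_2 C ->
  (forall k, (0 < k <= n)%N -> C (vtx k)) -> fib_polygon `<=` C.
Proof.
move=> /convex_setE cvx Cv p Pp.
have /andP[x1 xn] := fib_polygon_bounds Pp; move/fib_polygonP: Pp => [lo up].
have n5 := natr_ge5.
have [|k [/andP[k0 kn] /andP[kx xk]]] := @ex_unit_interval n.-1 (p 0 0) ltac:(lia).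
  by rewrite x1 prednK //; lia.
have Clow : C (pt (p 0 0) (lower k p)).
  have := cvx (vtx k.+1) (vtx k) (p 0 0 - k%:R) (Cv k.+1 ltac:(lia)) (Cv k ltac:(lia)).
  rewrite (_ : _ *: _ + _ = pt (p 0 0) (lower k p)); first by apply; apply/andP; split; lra.
  by apply: row2P; rewrite !mxE /= /lower -natr1 ?exprS; ring.
have Cup : C (pt (p 0 0) (upper p)).
  have := cvx (vtx n) (vtx 1) ((p 0 0 - 1) / (n%:R - 1)) (Cv n ltac:(lia)) (Cv 1%N ltac:(lia)).
  rewrite (_ : _ *: _ + _ = pt (p 0 0) (upper p)).
    by apply; apply/andP; split; rewrite ?divr_ge0 ?ler_pdivrMr //; lra.
  have n10 : n%:R - 1 != 0 :> R by rewrite gt_eqF; lra.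
  by apply: row2P; rewrite !mxE /= ?/upper ?/slope; field.
have lk := lo k ltac:(lia).
(* When the vertical segment is a single point, the quotient used below as convex coefficient would
   have denominator 0. *)
have [e|ne] := eqVneq (lower k p) (upper p).
  suff -> : p = pt (p 0 0) (upper p) by [].
  by apply: row2P; rewrite ?pt_fst ?pt_snd //; lra.
have d0 : 0 < upper p - lower k p by rewrite lt_neqAle eq_sym subr_eq0 eq_sym ne /=; lra.
have := cvx _ _ ((p 0 1 - lower k p) / (upper p - lower k p)) Cup Clow.
rewrite (_ : _ *: _ + _ = p).
  by apply; apply/andP; split; rewrite ?divr_ge0 ?ler_pdivrMr //; lra.
by apply: row2P; rewrite !mxE /=; field; rewrite gt_eqF.
Qed.

Lemma PG_polygon : PG R n = fib_polygon.
Proof.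
apply/seteqP; split.
  apply: smallest_sub graph_points_sub; apply/convex_setE => p q t Pp Pq t01 i iN.
  rewrite dotrv_conv; have := Pp i iN; have := Pq i iN; nra.
move=> p Pp C [cvx GC]; apply: fib_polygon_sub Pp => // k kn.
by apply: GC; exact: vtx_graph_point.
Qed.

(** * The [n] edges of the Fibonacci polygon *)

Lemma vtx_fib_polygon k : (0 < k <= n)%N -> fib_polygon (vtx k).
Proof. by move=> kn; apply: graph_points_sub; exact: vtx_graph_point. Qed.

Lemma vtx_inj : injective vtx.
Proof. by move=> j k /rowP /(_ 0); rewrite !pt_fst => /eqP; rewrite eqr_nat => /eqP. Qed.

Definition fib_edge k := polygon_edge n edge_normal edge_offset k.

Lemma fib_edge_ends k : (k < n)%N ->
  exists p q, [/\ fib_edge k p, fib_edge k q & p <> q].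
Proof.
case: k => [|k] kn.
  exists (vtx 1), (vtx n); split; [split|split|].
  - by apply: vtx_fib_polygon; lia.
  - by apply/upper_eqE; exact: vtx_upper1.
  - by apply: vtx_fib_polygon; lia.
  - by apply/upper_eqE; exact: vtx_uppern.
  - by move=> /vtx_inj; lia.
exists (vtx k.+1), (vtx k.+2); split; [split|split|].
- by apply: vtx_fib_polygon; lia.
- by apply/lower_eqE => //; exact: vtx_lower_tight.
- by apply: vtx_fib_polygon; lia.
- by apply/lower_eqE => //; exact: vtx_lower_tightS.
- by move=> /vtx_inj; lia.
Qed.

Lemma fib_polygon_full : has_aff 3 fib_polygon.
Proof.
apply: (@has_aff3P _ _ (vtx 1) (vtx 2) (vtx 3)); do ?[by apply: vtx_fib_polygon; lia].
by rewrite !pt_fst !pt_snd; apply/eqP; lra.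
Qed.

(** For [j < k], some vertex of edge [j] misses edge [k]: vertex [j] if [j > 0]; for the upper edge,
    vertex 1 if [k > 1] and vertex [n] if [k = 1], as [2 * n < 2 ^ n]. *)
Lemma fib_edge_inj : {in `I_n &, injective fib_edge}.
Proof.
suff H j k : (j < k < n)%N -> fib_edge j <> fib_edge k.
  move=> j k /[!inE] /= jn kn e.
  by have [jk|kj|//] := ltngtP j k; [case: (@H j k) | case: (@H k j)]; rewrite ?jk ?kj.
move=> /andP[jk kn] e.
have tight i : fib_edge j (vtx i) -> 2 ^+ k * (i%:R - k%:R + 1) = 2 ^+ i :> R.
  rewrite e => -[_ /= /lower_eqE] => /(_ ltac:(lia)).
  by rewrite /lower pt_fst pt_snd; lra.
have kpos : 0 < 2 ^+ k :> R by rewrite exprn_gt0.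
case: j jk e tight => [|j] jk e tight; last first.
  have : fib_edge j.+1 (vtx j.+1).
    split; first by apply: vtx_fib_polygon; lia.
    by apply/lower_eqE => //; exact: vtx_lower_tight.
  move=> /tight h; have : 0 < 2 ^+ j.+1 :> R by rewrite exprn_gt0.
  rewrite -h pmulr_rgt0 //; have : j.+2%:R <= k%:R :> R by rewrite ler_nat.
  by rewrite -!natr1; lra.
have n5 := natr_ge5.
have : fib_edge 0 (vtx 1).
  split; first by apply: vtx_fib_polygon; lia.
  by apply/upper_eqE; exact: vtx_upper1.
move=> /tight; have [k1|k1] := eqVneq k 1%N; last first.
  have : 2%:R <= k%:R :> R by rewrite ler_nat; lia.
  by nra.
move=> _.
have : fib_edge 0 (vtx n).
  split; first by apply: vtx_fib_polygon; lia.
  by apply/upper_eqE; exact: vtx_uppern.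
by move=> /tight; have := expn_pred_gt; rewrite k1 expr1 expn_pred; lra.
Qed.

Lemma facets_fib_polygon : facets fib_polygon = fib_edge @` `I_n.
Proof.
have a0 i : (i < n)%N -> edge_normal i != 0 by move=> _; exact: edge_normal_neq0.
apply/seteqP; split=> [F|_ [i iN <-]].
  by move=> /(facet_polygon_edge a0 fib_polygon_full)[i iN ->]; exists i.
exact: polygon_edge_facet a0 fib_polygon_full fib_edge_ends _ iN.
Qed.

Lemma fib_edge_lower k : (0 < k < n)%N ->
  defined_by fib_polygon (lower k) (fun p => p 0 1) (fib_edge k).
Proof.
move=> /andP[k0 kn]; split=> [p /fib_polygonP[lo _]|]; first by apply: lo; rewrite k0.
by apply/seteqP; split=> p [Pp] /=; split=> //; apply/lower_eqE.
Qed.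

Lemma fib_edge_upper : defined_by fib_polygon (fun p => p 0 1) upper (fib_edge 0).
Proof.
split=> [p /fib_polygonP[]//|].
by apply/seteqP; split=> p [Pp] /=; split=> //; apply/upper_eqE.
Qed.

End FibonacciPolygon.

Theorem theorem4 (R : realType) (n : nat) (hn : (5 <= n)%N) :
  let P := PG R n in
  let y := fun p : 'rV[R]_2 => p 0 1 in
  let lower := fun (k : nat) (p : 'rV[R]_2) =>
    (2 ^+ k - 1) * p 0 0 + 2 ^+ k * (1 - k%:R) + n%:R in
  let upper := fun p : 'rV[R]_2 =>
    (2 ^+ n - n%:R - 1) / (n%:R - 1) * (p 0 0 - 1) + n%:R + 1 in
  [/\ facets P #= `I_n,
      forall k : nat, (1 <= k <= n - 1)%N ->
        exists2 F, facets P F & defined_by P (lower k) y F,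
      exists2 F, facets P F & defined_by P y upper F
    & forall F, facets P F ->
        (exists2 k : nat, (1 <= k <= n - 1)%N & defined_by P (lower k) y F) \/
        defined_by P y upper F].
Proof.
move=> P y lo up; rewrite /P (PG_polygon R hn) (facets_fib_polygon R hn).
split=> [|k kn||_ [[|k] kn <-]].
- exact: inj_card_eq (@fib_edge_inj R n hn).
- exists (@fib_edge R n k); first by exists k => //=; lia.
  by apply: fib_edge_lower => //; lia.
- exists (@fib_edge R n 0); first by exists 0%N => //=; lia.
  exact: fib_edge_upper.
- by right; exact: fib_edge_upper.
- left; exists k.+1; first by move: kn => /=; lia.
  by apply: fib_edge_lower.
Qed.
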